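(* Let $A\in\mathbb{R}^{n\times n}$, $B\in\mathbb{R}^{n\times m}$ with $m\le n$, let $W\subseteq\mathbb{R}^n$ be nonempty, and let $X\subseteq\mathbb{R}^n$ and $U\subseteq\mathbb{R}^m$ be compact. Then for any $\varepsilon\in\mathbb{R}_{>0}$ there exists $i\in\mathbb{Z}_{\ge0}$ such that $$R_i\subseteq R_{i+n}+\varepsilon\mathbb{B}.$$
   Context: $\mathbb{B}$ denotes the closed unit ball of the infinity norm in $\mathbb{R}^n$. Sums of sets are Minkowski sums (a sum with the empty set is empty), and $x+W$ means $\{x\}+W$. For $R\subseteq\mathbb{R}^n$, $\operatorname{pre}(R)=\{x\in\mathbb{R}^n\mid \exists u\in U:\ Ax+Bu+W\subseteq R\}$. The sequence $(R_i)_{i\in\mathbb{Z}_{\ge0}}$ is defined by $R_0=X$, $R_{i+1}=\operatorname{pre}(R_i)\cap X$. *)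

(* Defs.v *)
From mathcomp Require Import all_boot all_order all_algebra.
From mathcomp Require Import classical_sets reals topology normedtype.

Set Implicit Arguments.
Unset Strict Implicit.
Unset Printing Implicit Defensive.

Import Order.TTheory GRing.Theory Num.Theory.
Import numFieldNormedType.Exports.

Local Open Scope classical_set_scope.
Local Open Scope ring_scope.

Definition minkowski_add (V : zmodType) (S T : set V) : set V :=
  [set x + y | x in S & y in T].

(* The norm on matrices is mx_norm, the maximum of the absolute values of the
   entries: on column vectors it is the infinity norm. *)
Definition unit_ball (R : realType) (n : nat) : set 'cV[R]_n :=
  [set x | `|x| <= 1].
Arguments unit_ball R n _ : clear implicits.

Definition pre (R : realType) (n m : nat) (A : 'M[R]_n) (B : 'M[R]_(n, m))
    (U : set 'cV[R]_m) (W S : set 'cV[R]_n) : set 'cV[R]_n :=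
  [set x | exists2 u, U u & minkowski_add [set A *m x + B *m u] W `<=` S].

Fixpoint pre_iter (R : realType) (n m : nat) (A : 'M[R]_n) (B : 'M[R]_(n, m))
    (U : set 'cV[R]_m) (W X : set 'cV[R]_n) (i : nat) : set 'cV[R]_n :=
  if i is j.+1 then pre A B U W (pre_iter A B U W X j) `&` X else X.

(* Main.v *)
(** A decreasing sequence of subsets of a compact space stabilises at scale
    [eps]: near a given point, either some term of the sequence misses a small
    ball, and then so do all later terms, or every term meets it.  Compactness
    makes the index uniform, and the sets [R_i] form such a sequence because
    [pre] is monotone. *)
Require Import Defs.
From mathcomp Require Import all_boot all_order all_algebra.
From mathcomp Require Import classical_sets boolp reals topology normedtype.

Set Implicit Arguments.
Unset Strict Implicit.
Unset Printing Implicit Defensive.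

Import Order.TTheory GRing.Theory Num.Theory.
Import numFieldNormedType.Exports.

Local Open Scope classical_set_scope.
Local Open Scope ring_scope.

Lemma compact_nonincreasing_eventually_close (R : realType)
    (T : pseudoMetricType R) (K : set T) (S : nat -> set T) (eps : R) :
  compact K -> (forall i j, (i <= j)%N -> S j `<=` S i) -> 0 < eps ->
  \forall i \near \oo, forall x, K x -> S i x ->
    forall j, exists2 y, S j y & ball x eps y.
Proof.
move=> /compact_near_coveringP cK S_noninc eps0.
(* Near-covering form of compactness: it suffices to treat, for each [x] in [K], the pairs [(x', i)]
   with [x'] near [x] and [i] large. *)
apply: (cK nat \oo (fun i x => S i x -> forall j, exists2 y, S j y & ball x eps y)).
(* Halving the radius puts any two points of the ball around [x] within [eps] of each other. *)
move=> x _; have eps2 : 0 < eps / 2 by rewrite divr_gt0.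
have [[i0 S_miss]|S_meet] := pselect (exists i, ~ (S i `&` ball x (eps / 2) !=set0)).
  exists (ball x (eps / 2), [set i | (i0 <= i)%N]) => /=.
    by split; [exact: nbhsx_ballx | exists i0].
  (* The premise [S i x'] is contradictory: [x'] would lie in both [S i0] and the ball. *)
  move=> [x' i] /= [xx' i0i] Six'; case: S_miss.
  by exists x'; split=> //; apply: S_noninc Six'.
exists (ball x (eps / 2), setT) => /=.
  by split; [exact: nbhsx_ballx | exact: filterT].
move=> [x' i] /= [xx' _] _ j.
have [y [Sjy xy]] : S j `&` ball x (eps / 2) !=set0.
  by apply: contrapT => S_miss; apply: S_meet; exists j.
by exists y => //; apply: ball_splitr xy; exact: xx'.
Qed.

Lemma pre_monotone (R : realType) (n m : nat) (A : 'M[R]_n) (B : 'M[R]_(n, m))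
    (U : set 'cV[R]_m) (W S T : set 'cV[R]_n) :
  S `<=` T -> pre A B U W S `<=` pre A B U W T.
Proof. by move=> ST x [u Uu uS]; exists u => // y /uS /ST. Qed.

Lemma pre_iter_nonincreasing (R : realType) (n m : nat) (A : 'M[R]_n)
    (B : 'M[R]_(n, m)) (U : set 'cV[R]_m) (W X : set 'cV[R]_n) (i j : nat) :
  (i <= j)%N -> pre_iter A B U W X j `<=` pre_iter A B U W X i.
Proof.
(* For [i = 0] and a successor [j], the intersection with [X] gives the inclusion; [pre] then
   propagates it. *)
elim: j i => [|j IHj] [|i]; [by move=> _ x | by [] | by move=> _ x [] | ].
by move=> /IHj ij; apply: setSI; exact: pre_monotone.
Qed.

Lemma ball_minkowski_add (R : realType) (n : nat) (S : set 'cV[R]_n)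
    (eps : R) (x y : 'cV[R]_n) :
  0 < eps -> S y -> ball x eps y ->
  minkowski_add S [set eps *: b | b in unit_ball R n] x.
Proof.
move=> eps0 Sy [_ xy]; exists y => //; exists (x - y); last by rewrite addrC subrK.
exists (eps^-1 *: (x - y)); last by rewrite scalerA divff ?gt_eqF // scale1r.
(* The norm is a maximum over entries and the matrix ball is entrywise, so each entry is bounded
   separately. *)
rewrite /unit_ball /= /Num.Def.normr /= mx_normrE; apply: bigmax_le => //= -[i j] _.
rewrite !mxE normrM gtr0_norm ?invr_gt0 // ler_pdivrMl // mulr1.
by have := ltW (xy i j).
Qed.

Theorem lemma1 (R : realType) (n m : nat) (A : 'M[R]_n) (B : 'M[R]_(n, m))
    (hmn : (m <= n)%N) (W X : set 'cV[R]_n) (U : set 'cV[R]_m)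
    (hW : W !=set0) (hX : compact X) (hU : compact U)
    (eps : R) (heps : 0 < eps) :
  exists i : nat,
    pre_iter A B U W X i `<=`
    minkowski_add (pre_iter A B U W X (i + n)%N)
                  [set eps *: b | b in unit_ball R n].
Proof.
have [i _ close] := compact_nonincreasing_eventually_close hX
  (@pre_iter_nonincreasing _ _ _ A B U W X) heps.
exists i => x Rix.
have Xx : X x := pre_iter_nonincreasing (leq0n i) Rix.
(* Closeness holds against every term of the sequence; [i + n] is one instance. *)
have [y Ry xy] := close i (leqnn i) x Xx Rix (i + n)%N.
exact: ball_minkowski_add heps Ry xy.
Qed.
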